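(* Let $T$ be a hypercyclic bounded linear operator on an infinite dimensional Banach space $X$ such that $T\oplus T$ is not hypercyclic on $X\oplus X$. Then the operator $T\oplus -T$ on $X\oplus X$, $(u,v)\mapsto (Tu,-Tv)$, is convex-cyclic but not weakly hypercyclic, and $(T\oplus -T)^2$ is not cyclic.
   Context: For a bounded linear operator $A$ on a Banach space $Z$ and $z\in Z$, the orbit is $Orb(A,z)=\{A^n z : n=0,1,2,\ldots\}$. $A$ is hypercyclic (resp. weakly hypercyclic) if some orbit is dense in the norm (resp. weak) topology of $Z$; $A$ is cyclic if the linear span of some orbit is dense in $Z$; $A$ is convex-cyclic if the convex hull of some orbit is dense in $Z$. *)

(* Defs.v *)
From HB Require Import structures.
From mathcomp Require Import all_boot all_order all_algebra.
From mathcomp Require Import all_classical all_reals all_analysis.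
From mathcomp Require Import complex.

Set Implicit Arguments.
Unset Strict Implicit.
Unset Printing Implicit Defensive.

Import Order.TTheory GRing.Theory Num.Theory.
Import numFieldNormedType.Exports.

Local Open Scope classical_set_scope.
Local Open Scope ring_scope.

Definition orbit (Z : Type) (A : Z -> Z) (z : Z) : set Z :=
  range (fun n : nat => iter n A z).

Definition linear_span (K : numFieldType) (Z : lmodType K) (S : set Z) : set Z :=
  smallest [set V : set Z | GRing.submod_closed [in V]] S.

(* Over R[i] the order is partial and 0 <= t <= 1 forces t to be real, so that
   [convex_set] is real convexity for complex scalars as well. *)
Definition convex_hull (K : numFieldType) (Z : lmodType K) (S : set Z) : set Z :=
  smallest (@convex_set K Z) S.

Definition infinite_dimensional (K : numFieldType) (Z : lmodType K) : Prop :=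
  ~ exists s : seq Z, linear_span [set` s] = [set: Z].

(* The carrier Z with the coarsest topology for which all the norm-continuous
   linear functionals on Z are continuous. *)
Definition weak (K : numFieldType) (Z : normedModType K) : topologicalType :=
  sup_topology (fun f : {f : {linear Z -> K^o} | continuous f} =>
    Topological.on (initial_topology (sval f))).

Section Operators.
Variables (K : numFieldType) (Z : normedModType K) (A : Z -> Z).

Definition hypercyclic : Prop := exists z : Z, dense (orbit A z).

Definition weakly_hypercyclic : Prop :=
  exists z : Z, dense (orbit A z : set (weak Z)).

Definition cyclic : Prop := exists z : Z, dense (linear_span (orbit A z)).

Definition convex_cyclic : Prop := exists z : Z, dense (convex_hull (orbit A z)).

End Operators.

Definition direct_sum (X Y : Type) (A : X -> X) (B : Y -> Y) (p : X * Y) : X * Y :=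
  (A p.1, B p.2).

(* Main.v *)
(* A vector [(x, y)] cyclic for [T (+) T] yields operators [P] commuting with
   [T] that send [(x, y)] into any prescribed box. Applying two of them to some
   [x'] near [x] with [T^n x'] near [y] shows that [T (+) T] is topologically
   transitive, hence hypercyclic by Baire (Grivaux). So [T (+) T], and with it
   [(T (+) -T)^2], is not cyclic. If [A] is weakly hypercyclic, one of the two
   halves of a weakly dense orbit (even and odd exponents) spans a dense
   subspace: otherwise Hahn-Banach gives two nonzero functionals, each killing
   one half, and the weakly open set where neither vanishes misses the orbit. So
   [A^2] is cyclic, and [T (+) -T] cannot be weakly hypercyclic. Finally, if [x]
   is hypercyclic for [T], both [{T^(2n) x}] and [{T^(2m+1) x}] are dense
   (Ansari), so the midpoints of [(p, p)] and [(q, -q)], with [p] and [q] in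
   these sets, are dense in [X (+) X]. *)
From HB Require Import structures.
Require Import Defs.
From mathcomp Require Import all_boot all_order all_algebra.
From mathcomp Require Import all_classical all_reals all_analysis.
From mathcomp Require Import complex ring.

Import Defs.
Import Order.TTheory GRing.Theory Num.Theory.
Import numFieldNormedType.Exports.

Local Open Scope classical_set_scope.
Local Open Scope ring_scope.

(** * Density and hypercyclic vectors *)

Lemma closure_ballP {K : numFieldType} {Z : normedModType K} (S : set Z) x :
  closure S x <-> forall e : K, 0 < e -> exists2 y, S y & `|x - y| < e.
Proof.
split=> [cSx e e0|h B /nbhs_ballP[e /= e0 xeB]].
  have [y [Sy]] := cSx _ (nbhsx_ballx x e e0).
  by rewrite -ball_normE; exists y.
have [y Sy xy] := h e e0; exists y; split=> //; apply: xeB.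
by rewrite -ball_normE.
Qed.

Lemma dense_ballP {K : numFieldType} {Z : normedModType K} (S : set Z) :
  dense S <-> forall x (e : K), 0 < e -> exists2 y, S y & ball x e y.
Proof.
split=> [dS x e e0|h O [x Ox] oO].
  have [|y [/interior_subset xy Sy]] := dS (ball x e)^° _ (open_interior _).
    by exists x; exact: nbhsx_ballx.
  by exists y.
have /nbhs_ballP[e /= e0 xeO] : nbhs x O by exact: open_nbhs_nbhs.
by have [y Sy xy] := h x e e0; exists y; split=> //; exact: xeO.
Qed.

Lemma dense_normP {K : numFieldType} {Z : normedModType K} (S : set Z) :
  dense S <-> forall x (e : K), 0 < e -> exists2 y, S y & `|x - y| < e.
Proof.
by rewrite dense_ballP; split=> h x e /(h x)[y Sy xy]; exists y;
  rewrite // -ball_normE in xy *.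
Qed.

Lemma dense_closureP {K : numFieldType} {Z : normedModType K} (S : set Z) :
  dense S <-> forall x, closure S x.
Proof.
rewrite dense_normP; split=> h x; first by apply/closure_ballP => e; exact: h.
by move/closure_ballP: (h x).
Qed.

Lemma closure_map {S U : topologicalType} (f : S -> U) (A : set S) (B : set U) z :
  continuous f -> (forall x, A x -> B (f x)) -> closure A z -> closure B (f z).
Proof.
move=> cf AB cAz V /cf /cAz [x [Ax Vx]]; exists (f x); split=> //; exact: AB.
Qed.

Lemma continuous_iter {S : topologicalType} (f : S -> S) n :
  continuous f -> continuous (iter n f).
Proof.
move=> cf; elim: n => [|n IH] x /=; first exact: cvg_id.
exact: (continuous_comp (IH x) (cf _)).
Qed.

Lemma iter_linear {K : numFieldType} {Z : lmodType K} (T : {linear Z -> Z}) n a b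
  (x y : Z) : iter n T (a *: x + b *: y) = a *: iter n T x + b *: iter n T y.
Proof. by elim: n => //= n ->; rewrite linearD !linearZ. Qed.

Section AffineImage.
Variables (K : numFieldType) (Z : normedModType K) (T : {linear Z -> Z}).
Hypothesis cT : continuous T.
Variables (x : Z) (a b : K).
Hypotheses (dx : dense (orbit T x)) (ab0 : a != 0 \/ b != 0).

Let S (z : Z) : Z := a *: z + b *: T z.

Let SZD c d u v : S (c *: u + d *: v) = c *: S u + d *: S v.
Proof.
have TD : T (c *: u + d *: v) = c *: T u + d *: T v by rewrite linearD !linearZ.
rewrite /S TD !scalerDr !scalerA (mulrC a c) (mulrC a d).
by rewrite (mulrC b c) (mulrC b d) addrACA.
Qed.

Let rangeSZ c u : range S u -> range S (c *: u).
Proof. by case=> w _ <-; exists (c *: w + 0 *: 0) => //; rewrite SZD scale0r addr0. Qed.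

Let TS u : T (S u) = S (T u).
Proof. by rewrite /S linearD !linearZ. Qed.

(* With [l := - a / b], [T^n x] equals [l^n x] modulo the range of [S]; the
   orbit comes near [2 x] (if [|l| <= 1]) or near [0] (if [|l| >= 1]), which
   forces [x] itself to be near the range. *)
Let x_closure : closure (range S) x.
Proof.
apply/closure_ballP => e e0.
have [b0|b0] := eqVneq b 0.
  have a0 : a != 0 by case: ab0; rewrite // b0 eqxx.
  exists x; last by rewrite subrr normr0.
  exists (a^-1 *: x) => //.
  by rewrite /S b0 scale0r addr0 scalerA divff // scale1r.
pose l := - (a / b).
have Tx : T x = l *: x + b^-1 *: S x.
  by rewrite /S scalerDr !scalerA mulVf // scale1r addrA -scalerDl /l
    (mulrC b^-1) addNr scale0r add0r.
have mod_range n : exists w, iter n T x = l ^+ n *: x + S w.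
  elim: n => [|n [w IH]].
    by exists 0; rewrite expr0 scale1r /S !(scaler0, linear0, addr0).
  exists ((l ^+ n * b^-1) *: x + 1 *: T w).
  rewrite iterS IH linearD linearZ /= Tx SZD TS scalerDr !scalerA exprSr.
  by rewrite scale1r; exact/esym/addrA.
(* If [T^n x] is within [e * d] of [c x], then [(c - l^n) x] is that close to the range; dividing by
   [c - l^n], of modulus at least [d], brings the range within [e] of [x]. *)
have near_range c n d : `|c *: x - iter n T x| < e * d -> 0 < d ->
    d <= `|c - l ^+ n| -> exists2 y, range S y & `|x - y| < e.
  have [w ->] := mod_range n => + d0 dl.
  set k := c - _ in dl; have k0 : k != 0 by rewrite -normr_gt0 (lt_le_trans d0).
  rewrite opprD addrA -scalerBl -/k => h.
  exists (k^-1 *: S w); first by apply: rangeSZ; exists w.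
  have -> : x - k^-1 *: S w = k^-1 *: (k *: x - S w).
    by rewrite scalerBr scalerA mulVf // scale1r.
  rewrite normrZ normfV ltr_pdivrMl ?normr_gt0 //.
  by apply: lt_le_trans h _; rewrite mulrC ler_wpM2r // ltW.
have /orP[l1|l1] : (`|l| <= 1) || (1 <= `|l|) by rewrite real_leVge.
  have /dense_normP/(_ (2 *: x) e e0)[_ [n _ <-] h] := dx.
  apply: (near_range 2 n 1); rewrite ?mulr1 //.
  apply: le_trans (lerB_dist _ _); rewrite normrX normr_nat.
  rewrite lerBrDl -lerBrDr; apply: (le_trans (exprn_ile1 _ (normr_ge0 l) l1)).
  by rewrite lerBrDl -[1 + 1](natrD K 1 1).
have /dense_normP/(_ 0 e e0)[_ [n _ <-] h] := dx.
apply: (near_range 0 n 1); rewrite ?mulr1 ?scale0r //.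
by rewrite sub0r normrN normrX exprn_ege1.
Qed.

(** The closure of the range is invariant under [T] and contains [x], hence the whole dense
    orbit. *)
Let dense_range : dense (range S).
Proof.
apply/dense_closureP => z.
have h n : closure (range S) (iter n T x).
  elim: n => //= n; apply: closure_map => // _ [w _ <-].
  by rewrite TS; exists (T w).
apply: (@closed_closure _ (range S)); move/dense_closureP: dx => /(_ z).
by apply: closureS => _ [n _ <-].
Qed.

(** [S] commutes with [T], so it maps the orbit of [x] onto that of [S x]; a continuous map with
    dense range sends dense sets to dense sets. *)
Lemma dense_orbit_affine : dense (orbit T (a *: x + b *: T x)).
Proof.
have cS : continuous S.
  move=> z; apply: cvgD; first by apply: cvgZl_tmp.
  by apply: cvgZl_tmp; exact: cT.
move=> O O0 oO; have [y [Oy [w _ ew]]] := dense_range _ O0 oO.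
have [|y' [On [n _ en]]] := dx (S @^-1` O) _ (open_comp (fun z _ => cS z) oO).
  by exists w; rewrite /= ew.
exists (S (iter n T x)); split; first by rewrite en.
by exists n => //; rewrite iter_linear /S -iterSr iterS.
Qed.

End AffineImage.

Lemma dense_orbit_iter {K : numFieldType} {Z : normedModType K}
    (T : {linear Z -> Z}) (x : Z) n :
  continuous T -> dense (orbit T x) -> dense (orbit T (iter n T x)).
Proof.
move=> cT dx; elim: n => //= n IH.
(* [T] itself is the affine map with [a = 0] and [b = 1]. *)
rewrite -[T _]scale1r -[_ *: _]add0r -(scale0r (iter n T x)).
by apply: dense_orbit_affine => //; right; exact: oner_neq0.
Qed.

(** * Ansari's theorem for the square *)

(* [rho] is the inclusion of the reals in [K], the scalar field being [R] or
   [R[i]]. *)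
Definition real_embedding {R : realType} {K : numFieldType}
    (rho : {rmorphism R -> K}) : Prop :=
  {mono rho : x y / x <= y} /\ forall a : K, 0 <= a -> exists r, a = rho r.

Lemma real_embedding_id (R : realType) :
  @real_embedding R R (idfun : {rmorphism R -> R}).
Proof. by split=> // a _; exists a. Qed.

Lemma real_embedding_complex (R : realType) :
  @real_embedding R R[i] (real_complex R : {rmorphism R -> R[i]}).
Proof.
split=> [x y|[a b]]; first exact: lecR.
by rewrite lecE /= => /andP[/eqP -> _]; exists a.
Qed.

Lemma ex_real_embedding {R : realType} {K : numFieldType} :
  K = R :> numFieldType \/ K = R[i] :> numFieldType ->
  exists rho : {rmorphism R -> K}, real_embedding rho.
Proof.
by case=> ->; [exists idfun; exact: real_embedding_id|
  exists (real_complex R); exact: real_embedding_complex].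
Qed.

Section RealEmbedding.
Context {R : realType} {K : numFieldType} {rho : {rmorphism R -> K}}.
Hypothesis rhoP : real_embedding rho.

Lemma real_embedding_lt : {mono rho : x y / x < y}.
Proof. exact/leW_mono/rhoP.1. Qed.

Lemma real_embedding_norm r : `|rho r| = rho `|r|.
Proof.
have [r0|r0] := leP 0 r.
  by rewrite (ger0_norm r0) ger0_norm // -(rmorph0 rho) rhoP.1.
by rewrite (ltr0_norm r0) rmorphN ler0_norm // -(rmorph0 rho) rhoP.1 ltW.
Qed.

Lemma real_embedding_gt0 (e : K) : 0 < e -> exists2 d, 0 < d & e = rho d.
Proof.
move=> e0; have [d ed] := rhoP.2 e (ltW e0).
by exists d; rewrite // -real_embedding_lt rmorph0 -ed.
Qed.

Lemma real_embedding_archi (e : K) : 0 < e -> exists n, n.+1%:R^-1 < e.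
Proof.
move=> /real_embedding_gt0[d d0 ->]; exists (Num.truncn d^-1).
rewrite -(rmorph_nat rho) -fmorphV real_embedding_lt invf_plt ?posrE //.
exact: truncnS_gt.
Qed.

End RealEmbedding.

Section Ansari.
Variables (R : realType) (K : numFieldType) (rho : {rmorphism R -> K}).
Hypothesis rhoP : real_embedding rho.
Variables (Z : normedModType K) (T : {linear Z -> Z}).
Hypothesis cT : continuous T.
Variable x : Z.
Hypothesis dx : dense (orbit T x).

Let gamma (t : R) : Z := rho (1 - t) *: x + rho t *: T x.

Let gammaE t : gamma t = x + rho t *: (T x - x).
Proof.
by rewrite /gamma rmorphB rmorph1 scalerBl scale1r scalerBr addrAC addrA.
Qed.

Let gamma_continuous : continuous gamma.
Proof.
move=> t; apply/cvgrPdist_lt => e e0.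
have c0 : 0 < `|T x - x| + 1 by rewrite ltr_wpDl.
have [d d0 ed] := real_embedding_gt0 rhoP _ (divr_gt0 e0 c0).
have : \forall s \near t, `|t - s| < d.
  by near=> s; near: s; exact: cvgr_dist_lt.
apply: filterS => s ts.
have -> : gamma t - gamma s = rho (t - s) *: (T x - x).
  by rewrite !gammaE opprD addrACA subrr add0r -scalerBl -rmorphB.
rewrite normrZ (real_embedding_norm rhoP).
apply: (@le_lt_trans _ _ (rho `|t - s| * (`|T x - x| + 1))).
  by rewrite ler_wpM2l ?lerDl // -(rmorph0 rho) rhoP.1.
by rewrite -ltr_pdivlMr // ed (real_embedding_lt rhoP).
Unshelve. all: by end_near. Qed.

Let even := closure (range (fun n => iter n.*2 T x)).
Let odd := closure (range (fun n => iter n.*2.+1 T x)).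

Let evenT z : even z -> odd (T z).
Proof.
by apply: closure_map => // _ [n _ <-]; exists n.
Qed.

Let oddT z : odd z -> even (T z).
Proof. by apply: closure_map => // _ [n _ <-]; exists n.+1. Qed.

Let even_odd z : even z \/ odd z.
Proof.
have /dense_closureP/(_ z) := dx.
suff -> : orbit T x = range (fun n => iter n.*2 T x) `|`
    range (fun n => iter n.*2.+1 T x) by rewrite closureU.
apply/seteqP; split=> [_ [n _ <-]|_ [] [n _ <-]].
- rewrite -[n]odd_double_half; case: (ssrnat.odd n); last by left; exists n./2.
  by right; exists n./2.
- by exists n.*2.
- by exists n.*2.+1.
Qed.

(* The segment from [x] to [T x] consists of hypercyclic vectors and is
   connected, so one of them lies in both closures. *)
Lemma dense_orbit_sqr : dense (range (fun n => iter n.*2 T x)).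
Proof.
have even0 : even (gamma 0).
  rewrite /gamma subr0 rmorph1 rmorph0 scale1r scale0r addr0.
  by apply: subset_closure; exists 0%N.
have odd1 : odd (gamma 1).
  rewrite /gamma subrr rmorph1 rmorph0 scale1r scale0r add0r.
  by apply: subset_closure; exists 0%N.
have [t [et ot]] : exists t, even (gamma t) /\ odd (gamma t).
  apply: contrapT => /forallNP disj.
  (* If disjoint, the closed sets [even] and [odd] would split the segment: [even] cuts out a
     nonempty part, closed and also open as the complement of [odd], so connectedness puts [gamma 1]
     in both. *)
  suff e : `[0, 1]%classic `&` gamma @^-1` even = `[0, 1]%classic.
    have : (`[0, 1]%classic `&` gamma @^-1` even) 1.
      by rewrite e /= in_itv /= ler01 lexx.
    by case=> _ e1; case: (disj 1); split.
  apply: (@segment_connected R 0 1).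
  - by exists 0; split => //=; rewrite in_itv /= lexx ler01.
  - exists (gamma @^-1` (~` odd)).
      apply: open_comp => [? _|]; first exact: gamma_continuous.
      by apply: closed_openC; exact: closed_closure.
    apply/seteqP; split=> s [s01 h]; split=> //; last by case: (even_odd (gamma s)).
    by move=> os; case: (disj s).
  - exists (gamma @^-1` even) => //.
    by apply: closed_comp => [? _|]; [exact: gamma_continuous|exact: closed_closure].
(* [T] exchanges [even] and [odd], so the orbit of [gamma t] stays in their intersection; as it is
   dense, the closed set [even] is everything. *)
have both n : even (iter n T (gamma t)) /\ odd (iter n T (gamma t)).
  by elim: n => //= n [e o]; split; [exact: oddT|exact: evenT].
have : dense (orbit T (gamma t)).
  apply: dense_orbit_affine => //.
  have [t0|t0] := eqVneq t 0; last by right; rewrite fmorph_eq0.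
  by left; rewrite t0 subr0 rmorph1 oner_eq0.
rewrite !dense_closureP => h z; apply: (@closed_closure _ (range (fun n => iter n.*2 T x))).
by apply: closureS (h z) => _ [n _ <-]; exact: (both n).1.
Qed.

End Ansari.

(** * Convex-cyclicity *)

Lemma iter_direct_sum {X Y : Type} (A : X -> X) (B : Y -> Y) n p :
  iter n (direct_sum A B) p = (iter n A p.1, iter n B p.2).
Proof. by elim: n => [|n /= ->]; first by case: p. Qed.

Lemma iter_double_opp {K : numFieldType} {Z : lmodType K} (T : {linear Z -> Z})
  n y : iter n.*2 (\- T) y = iter n.*2 T y.
Proof. by elim: n => //= n ->; rewrite linearN opprK. Qed.

Lemma convex_hull_midpoint {K : numFieldType} {Z : lmodType K} (S : set Z) p q :
  S p -> S q -> convex_hull S (2^-1 *: (p + q)).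
Proof.
move=> Sp Sq A /= [cA SA].
have half_le1 : 2^-1 <= 1 :> K by rewrite invf_le1 // ler1n.
have half_ge0 : 0 <= 2^-1 :> K by rewrite invr_ge0.
have := cA p q (Itv01 half_ge0 half_le1) (mem_set (SA _ Sp)) (mem_set (SA _ Sq)).
have e : 1 - 2^-1 = 2^-1 :> K by rewrite {1}(splitr 1) div1r addrK.
rewrite inE; congr (A _); rewrite scalerDr; congr (_ + _ *: _); exact: e.
Qed.

(** The midpoint of [(p, p)] and [(q, - q)] is near [(u, v)] as soon as [p] is near [u + v] and [q]
    near [u - v]. *)
Lemma convex_cyclic_direct_sum_opp {R : realType} {K : numFieldType}
    (rho : {rmorphism R -> K}) {X : normedModType K} (T : {linear X -> X}) :
  real_embedding rho -> continuous T -> hypercyclic T ->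
  convex_cyclic (direct_sum T (\- T)).
Proof.
move=> rhoP cT [x dx]; exists (x, x); apply/dense_ballP => -[u v] e e0.
have /dense_normP/(_ (u + v) e e0)[_ [n _ <-] nuv] :=
  dense_orbit_sqr _ _ _ rhoP _ _ cT _ dx.
(* Odd powers on [x] are even powers on [T x], which is hypercyclic too. *)
have dTx := dense_orbit_iter T x 1 cT dx.
have /dense_normP/(_ (u - v) e e0)[_ [m _ <-] muv] :=
  dense_orbit_sqr _ _ _ rhoP _ _ cT _ dTx.
set p := iter _ _ _ in nuv; set q := iter _ _ _ in muv.
exists (2^-1 *: ((p, p) + (q, - q))).
  apply: convex_hull_midpoint; [exists n.*2|exists m.*2.+1] => //.
    by rewrite iter_direct_sum iter_double_opp.
  by rewrite iter_direct_sum !iterS iter_double_opp /q -iterSr iterS.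
have half z w a b : `|z - a| < e -> `|w - b| < e ->
    `|2^-1 *: (z + w) - 2^-1 *: (a + b)| < e.
  move=> za wb; rewrite -scalerBr normrZ gtr0_norm ?invr_gt0 // mulrC.
  rewrite ltr_pdivrMr // mulr_natr mulr2n opprD addrACA.
  exact: le_lt_trans (ler_normD _ _) (ltrD za wb).
have halfK (z : X) : z = 2^-1 *: (z + z).
  by rewrite -mulr2n -[z *+ 2]scaler_nat scalerA mulVf ?pnatr_eq0 // scale1r.
split; rewrite -ball_normE /=.
  suff -> : u = 2^-1 *: (u + v + (u - v)) by exact: half.
  by rewrite addrACA subrr addr0 -halfK.
suff -> : v = 2^-1 *: (u + v + - (u - v)).
  by apply: half => //; rewrite -opprD normrN.
by rewrite opprB addrC subrKA -halfK.
Qed.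

(** * Baire's theorem and transitive operators *)

HB.instance Definition _ (T U : puniformType) := Pointed.on (T * U)%type.

Section ProdComplete.
Variables T U : completeType.

(** Needed to apply Baire's theorem on [X * X]; a Cauchy filter converges to the pair of limits of
    its projections. *)
Lemma prod_complete (F : set_system (T * U)) :
  ProperFilter F -> cauchy F -> cvg F.
Proof.
move=> FF Fc.
have /cauchy_cvg c1 : cauchy (fst @ F).
  move=> A /= entA; rewrite near_simpl -near2E near_map2; apply: Fc.
  exists (A, setT) => /=; first by split=> //; exact: entourageT.
  by move=> [[a b] [c d]] [/= Aab _]; exists ((a, c), (b, d)).
have /cauchy_cvg c2 : cauchy (snd @ F).
  move=> A /= entA; rewrite near_simpl -near2E near_map2; apply: Fc.
  exists (setT, A) => /=; first by split=> //; exact: entourageT.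
  by move=> [[a b] [c d]] [/= _ Acd]; exists ((a, c), (b, d)).
apply/cvg_ex; exists (lim (fst @ F), lim (snd @ F)).
have : (fun p : T * U => (p.1, p.2)) @ F --> (lim (fst @ F), lim (snd @ F)).
  exact: cvg_pair.
by rewrite (_ : (fun p : T * U => (p.1, p.2)) = id) //; apply/funext => -[].
Qed.

HB.instance Definition _ := Uniform_isComplete.Build (T * U)%type prod_complete.

End ProdComplete.

HB.instance Definition _ (K : numFieldType) (X Y : completeNormedModType K) :=
  Complete.on (X * Y)%type.

(** The order of [K] may be partial, but positive elements are real and so comparable. *)
Lemma pos_lower_bound {K : numDomainType} (a b : K) :
  0 < a -> 0 < b -> exists2 t, 0 < t & t <= a /\ t <= b.
Proof.
move=> a0 b0; have /orP[ab|ba] := real_leVge (gtr0_real a0) (gtr0_real b0).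
  by exists a.
by exists b.
Qed.

Section Baire.
Variables (K : numFieldType) (Z : completeNormedModType K).
Hypothesis archi : forall e : K, 0 < e -> exists n, n.+1%:R^-1 < e.

(** Baire's theorem by nested balls: [archi] drives the radii to 0, so the centres form a Cauchy
    sequence, whose limit lies in every [F n]. *)
Lemma dense_bigcap_open (F : nat -> set Z) :
  (forall i, open (F i)) -> (forall i, dense (F i)) -> dense (\bigcap_i F i).
Proof.
move=> oF dF; apply/dense_normP => x0 e0 e0_gt0.
(* The factor 2 leaves room for the limit of the centres, which need not stay in the open ball of
   radius [c.2]. *)
pose shrinks n (b c : Z * K) := [/\ 0 < c.2, c.2 < n.+1%:R^-1 &
  forall y, `|c.1 - y| < 2 * c.2 -> `|b.1 - y| < b.2 /\ F n y].
(* [choice] asks for a successor of every pair; a radius that is not positive gets a dummy one. *)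
have step (nb : nat * (Z * K)) :
    exists c, 0 < nb.2.2 -> shrinks nb.1 nb.2 c.
  case: nb => n [x r] /=; have [r0|_] := boolP (0 < r); last by exists (x, r).
  have /dense_normP/(_ x r r0)[c Fc xc] := dF n.
  have : nbhs c (F n) by exact: open_nbhs_nbhs.
  move=> /nbhs_ballP[s /= s0 csF].
  have rc0 : 0 < r - `|x - c| by rewrite subr_gt0.
  have [t t0 [ts tr]] := pos_lower_bound _ _ s0 rc0.
  have n0 : 0 < n.+1%:R^-1 :> K by rewrite invr_gt0.
  have [q q0 [qt qn]] := pos_lower_bound _ _ t0 n0.
  exists (c, q / 2) => _; split=> /=.
  - by rewrite divr_gt0.
  - by apply: lt_le_trans qn; rewrite gtr_pMr // invf_lt1 // ltr1n.
  move=> y; rewrite mulrC divfK ?pnatr_eq0 // => cy; split.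
    rewrite -(subrKA c); apply: le_lt_trans (ler_normD _ _) _.
    rewrite -ltrBrDl; exact: lt_le_trans cy (le_trans qt tr).
  by apply: csF; rewrite -ball_normE /=; exact: lt_le_trans cy (le_trans qt ts).
have [f fP] := choice step.
pose fix a n := if n is m.+1 then f (m, a m) else (x0, e0).
have a_gt0 n : 0 < (a n).2 by elim: n => //= n IH; case: (fP (n, a n) IH).
have aP n : shrinks n (a n) (a n.+1) by exact: (fP (n, a n) (a_gt0 n)).
have a_ball n k y : `|(a (n + k)%N).1 - y| < (a (n + k)%N).2 ->
    `|(a n).1 - y| < (a n).2.
  elim: k y => [|k IH] y; first by rewrite addn0.
  rewrite addnS => h; apply: IH; have [_ _ /(_ y) []//] := aP (n + k)%N.
  by apply: lt_trans h _; rewrite ltr_pMl // ltr1n.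
have a_in n k : `|(a n).1 - (a (n + k)%N).1| < (a n).2.
  by apply: (a_ball n k); rewrite subrr normr0.
have /cvg_ex[l al] : cvg ((fun n => (a n).1) @ \oo).
  apply/cauchy_cvgP; apply: cauchy_exP => e e_gt0.
  have [n ne] := archi _ e_gt0; exists (a n.+1).1, n.+1 => // m /= nm.
  rewrite -ball_normE; have := a_in n.+1 (m - n.+1)%N; rewrite subnKC // => am.
  by apply: lt_trans am (lt_trans _ ne); case: (aP n).
have lP n : `|(a n).1 - l| < (a n).2 /\ F n l.
  have [_ _ h] := aP n; apply: h.
  have : \forall k \near \oo, `|l - (a k).1| < (a n.+1).2.
    by move/cvgrPdist_lt: al; exact.
  case=> N _ /(_ (n.+1 + N)%N (leq_addl _ _)) /= lN.
  rewrite mulr_natl mulr2n.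
  apply: le_lt_trans (ler_distD (a (n.+1 + N)%N).1 _ _) _.
  by apply: ltrD (a_in n.+1 N) _; rewrite distrC.
by exists l; [move=> n _; case: (lP n)|case: (lP 0%N)].
Qed.

(** Birkhoff's transitivity theorem: the vectors whose orbit meets a given ball form an open set,
    dense by transitivity, and countably many balls suffice. *)
Lemma transitive_hypercyclic (A : Z -> Z) (d : nat -> Z) :
  continuous A -> dense (range d) ->
  (forall U V : set Z, open U -> open V -> U !=set0 -> V !=set0 ->
    exists n z, U z /\ V (iter n A z)) ->
  hypercyclic A.
Proof.
move=> cA dd trA.
pose B (i : nat * nat) := ball (d i.1) (i.2.+1%:R^-1 : K).
(* An index that codes no pair imposes no condition. *)
pose F k := if unpickle k is Some i then
  \bigcup_n (iter n A @^-1` B i) else [set: Z].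
have oB i : open (B i) by exact: ball_open.
have [|||z zF] := dense_bigcap_open F _ _ [set: Z] _ openT.
- move=> k; rewrite /F; case: unpickle => [i|]; last exact: openT.
  apply: bigcup_open => n _; apply: open_comp => // z _.
  exact: continuous_iter.
- move=> k; rewrite /F; case: unpickle => [i|]; last first.
    by move=> O [y Oy] _; exists y.
  move=> O O0 oO; have [|n [z [Oz Bz]]] := trA O (B i) oO (oB i) O0.
    by exists (d i.1); exact: ballxx.
  by exists z; split=> //; exists n.
- by exists 0.
case: zF => _ zF; exists z; apply/dense_normP => y e e0.
have e2 : 0 < e / 2 by rewrite divr_gt0.
have [j je] := archi _ e2.
have /dense_normP/(_ y _ e2)[_ [i _ <-] yi] := dd.
have := zF (pickle (i, j)) I; rewrite /F pickleK => -[n _].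
rewrite /= /B -ball_normE /= => dz; exists (iter n A z); first by exists n.
rewrite (splitr e); apply: le_lt_trans (ler_distD (d i) _ _) _.
exact: ltrD yi (lt_trans dz je).
Qed.

End Baire.

(** * Grivaux's theorem *)

(** The signs cancel in the square, so its orbits are the even halves of orbits of [direct_sum T T],
    and their spans are smaller. *)
Lemma cyclic_direct_sum_sqr {K : numFieldType} {X : normedModType K}
    (T : {linear X -> X}) :
  cyclic (direct_sum T (\- T) \o direct_sum T (\- T)) -> cyclic (direct_sum T T).
Proof.
move=> [z dz]; exists z => O O0 /(dz _ O0)[p [Op zp]]; exists p; split=> //.
move=> V [sV oV]; apply: zp; split=> // _ [n _ <-]; apply: oV.
exists n.*2 => //; elim: n => //= n ->; rewrite /direct_sum /=.
by rewrite linearN opprK.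
Qed.

Section Grivaux.
Variables (K : numFieldType) (X : completeNormedModType K).
Variables (T : {linear X -> X}).
Hypothesis archi : forall e : K, 0 < e -> exists n, n.+1%:R^-1 < e.
Hypothesis cT : continuous T.

(** The pairs [(P u, P v)], with [P] continuous and commuting with [T], form a subspace that
    contains the orbit. Polynomials in [T] are the model for [P]. *)
Lemma linear_span_direct_sum u v p :
  linear_span (orbit (direct_sum T T) (u, v)) p ->
  exists P : {linear X -> X}, [/\ continuous P,
    forall z, P (T z) = T (P z) & p = (P u, P v)].
Proof.
pose V : set (X * X) := [set p | exists P : {linear X -> X}, [/\ continuous P,
    forall z, P (T z) = T (P z) & p = (P u, P v)]].
move=> spanp; apply: (spanp V); split=> /=.
  split=> [|a p1 p2]; rewrite !inE.
    exists (\0 : {linear X -> X}); split=> // [z|z]; last by rewrite linear0.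
    exact: cvg_cst.
  move=> [P1 [cP1 TP1 ->]] [P2 [cP2 TP2 ->]].
  have cP : continuous (fun z => a *: P1 z + P2 z).
    by move=> z; apply: cvgD; [apply: cvgZl_tmp; exact: cP1|exact: cP2].
  exists (a \*: P1 \+ P2 : {linear X -> X}); split=> // z.
  by rewrite /= TP1 TP2 linearD linearZ.
move=> _ [n _ <-]; rewrite iter_direct_sum.
elim: n => [|n [P [cP TP [Pu Pv]]]].
  by exists (idfun : {linear X -> X}); split=> // z; exact: cvg_id.
exists (T \o P : {linear X -> X}); split=> [z|z|]; last by rewrite /= Pu Pv.
  by apply: continuous_comp; [exact: cP|exact: cT].
by rewrite /= TP.
Qed.

(* If [P (x, y)] and [Q (x, y)] lie in given boxes [U1 x V1] and [U2 x V2],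
   with [P] and [Q] commuting with [T], and [x'] close to [x] has [T^n x']
   close to [y], then [(P x', Q x')] is in [U1 x U2] and its [n]-th iterate in
   [V1 x V2]. *)
Lemma hypercyclic_direct_sum :
  hypercyclic T -> cyclic (direct_sum T T) -> hypercyclic (direct_sum T T).
Proof.
move=> [x0 dx0] [[x y] dxy].
(* Pairs of points of the dense orbit of [x0]: a countable dense subset of [X * X]. *)
pose d k := if unpickle k is Some (i, j) then (iter i T x0, iter j T x0) else 0.
apply: (@transitive_hypercyclic K (X * X)%type archi _ d).
- move=> p.
  have c1 : (fun q : X * X => T q.1) @ p --> T p.1.
    by apply: continuous_comp; [exact: cvg_fst|exact: cT].
  have c2 : (fun q : X * X => T q.2) @ p --> T p.2.
    by apply: continuous_comp; [exact: cvg_snd|exact: cT].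
  exact: cvg_pair c1 c2.
- apply/dense_ballP => -[u v] e e0.
  have /dense_ballP dx0P := dx0.
  have [_ [i _ <-] ui] := dx0P u e e0; have [_ [j _ <-] vj] := dx0P v e e0.
  by exists (d (pickle (i, j))); [exists (pickle (i, j))|rewrite /d pickleK].
move=> U V oU oV [[u1 u2] Uu] [[v1 v2] Vv].
have [[U1 U2] [/= nU1 nU2] sU] : nbhs (u1, u2) U by exact: open_nbhs_nbhs.
have [[V1 V2] [/= nV1 nV2] sV] : nbhs (v1, v2) V by exact: open_nbhs_nbhs.
(* Cyclicity puts some [(P x, P y)] in the box [A x B]; continuity of [P] extends this to
   neighbourhoods of [x] and [y]. *)
have pick (A B : set X) (a b : X) : nbhs a A -> nbhs b B -> exists P : {linear X -> X},
    [/\ continuous P, forall z, P (T z) = T (P z), nbhs x (P @^-1` A)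
     & nbhs y (P @^-1` B)].
  move=> nA nB; pose W : set (X * X) := fst @^-1` A^° `&` snd @^-1` B^°.
  have oW : open W.
    apply: openI; apply: open_comp => [? _|]; try exact: open_interior.
      exact: cvg_fst.
    exact: cvg_snd.
  have [|p [[/= Ap Bp] /linear_span_direct_sum[P [cP TP pE]]]] := dxy W _ oW.
    by exists (a, b).
  exists P; split=> //; rewrite pE /= in Ap Bp; exact: cP.
have [P [cP TP nPU nPV]] := pick _ _ _ _ nU1 nV1.
have [Q [cQ TQ nQU nQV]] := pick _ _ _ _ nU2 nV2.
have iterC (S : {linear X -> X}) n z :
    (forall z, S (T z) = T (S z)) -> S (iter n T z) = iter n T (S z).
  by move=> TS; elim: n => //= n <-.
have [|x' [/interior_subset[/= Px' Qx'] [i _ x'E]]] :=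
    dx0 (P @^-1` U1 `&` Q @^-1` U2)^° _ (open_interior _).
  by exists x; exact: filterI.
(* As a point of the orbit of [x0], [x'] has a dense orbit as well, so [y'] can be taken of the form
   [T^n x']. *)
have [|y' [/interior_subset[/= Py' Qy'] [n _ y'E]]] := dense_orbit_iter T x0 i cT dx0
    (P @^-1` V1 `&` Q @^-1` V2)^° _ (open_interior _).
  by exists y; exact: filterI.
exists n, (P x', Q x'); split; first exact: sU.
by apply: sV; rewrite iter_direct_sum /= -!iterC // -x'E y'E.
Qed.

End Grivaux.

(** * Hahn-Banach *)

Section HahnBanach.
Context {R : realType} {K : numFieldType} (rho : {rmorphism R -> K}).
Context {Z : lmodType K} (p : Z -> R).
Hypothesis p_subadd : forall u v, p (u + v) <= p u + p v.
Hypothesis p_homo : forall t v, 0 <= t -> p (rho t *: v) = t * p v.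

(* The graph of a real-linear functional that is defined on a real subspace of
   [Z] and dominated by [p]; the domination makes the graph single-valued. *)
Definition dominated_graph (G : set (Z * R)) : Prop :=
  [/\ G (0, 0),
      forall t u r v s, G (u, r) -> G (v, s) -> G (rho t *: u + v, t * r + s)
    & forall v r, G (v, r) -> r <= p v].

Lemma dominated_graph_maximal G0 : dominated_graph G0 ->
  exists G, [/\ G0 `<=` G, dominated_graph G &
    forall H, dominated_graph H -> G `<=` H -> H `<=` G].
Proof.
(* Adjoining [G0] inside [P] lets the empty chain, with its empty union, satisfy [P]. *)
move=> dG0; pose P G := dominated_graph (G `|` G0).
have [F FP totF|A [PA Amax]] := @Zorn_bigcup _ P.
  (* The extra member [set0] accounts for points that come from [G0] alone. *)
  pose F' := F `|` [set set0].
  have F'P X : F' X -> P X by case=> [/FP//|->]; rewrite /P set0U.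
  have inF' g : (\bigcup_(X in F) X `|` G0) g -> exists2 X, F' X & (X `|` G0) g.
    case=> [[X FX Xg]|G0g]; first by exists X; left.
    by exists set0; right.
  have F'in X : F' X -> X `|` G0 `<=` \bigcup_(Y in F) Y `|` G0.
    by case=> [FX|->] g [Xg|]; [left; exists X|right| |right].
  split.
  - by right; case: dG0.
  - move=> t u r v s /inF'[X F'X Xu] /inF'[Y F'Y Yv].
    have [XY|YX] : X `<=` Y \/ Y `<=` X.
      case: F'X F'Y => [FX|->] [FY|->]; [exact: totF|by right|by left|by left].
    + apply: (F'in Y F'Y); have [_ + _] := F'P Y F'Y; apply=> //.
      by case: Xu => [/XY|]; [left|right].
    + apply: (F'in X F'X); have [_ + _] := F'P X F'X; apply=> //.
      by case: Yv => [/YX|]; [left|right].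
  - by move=> v r /inF'[X F'X Xv]; have [_ _] := F'P X F'X; apply.
exists (A `|` G0); split=> // H dH AH.
have G0H : G0 `<=` H by move=> g G0g; apply: AH; right.
have [HA|HA] := pselect (H `<=` A); first by move=> g /HA; left.
case: (Amax H); last by rewrite /P (setUidl G0H).
by split=> // g Ag; apply: AH; left.
Qed.

(** The value [a] at [v0] must lie above every [r - p (u - v0)] and below every [p (w + v0) - s];
    subadditivity makes these compatible, and the supremum of the former works. *)
Lemma dominated_graph_extend G v0 : dominated_graph G ->
  exists H a, [/\ dominated_graph H, G `<=` H & H (v0, a)].
Proof.
move=> [G0 GL Gp].
pose S := [set x | exists2 ur, G ur & x = ur.2 - p (ur.1 - v0)].
have ubS w s : G (w, s) -> ubound S (p (w + v0) - s).
  move=> Gws _ [[u r] Gur ->] /=.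
  rewrite lerBlDr addrAC -lerBlDr opprK.
  have := GL 1 u r w s Gur Gws; rewrite rmorph1 scale1r mul1r => /Gp.
  move/le_trans; apply.
  have -> : u + w = (w + v0) + (u - v0) by rewrite addrACA subrr addr0 addrC.
  exact: p_subadd.
have supS : has_sup S.
  split; first by exists (0 - p (0 - v0)), (0, 0).
  by exists (p (0 + v0) - 0); exact: ubS.
pose a := sup S.
have a_ge u r : G (u, r) -> r - p (u - v0) <= a.
  by move=> Gur; apply: ub_le_sup; [case: supS|exists (u, r)].
have a_le w s : G (w, s) -> a <= p (w + v0) - s.
  by move=> Gws; apply: ge_sup; [case: supS|exact: ubS].
have GZ t u r : G (u, r) -> G (rho t *: u, t * r).
  by move=> Gu; have := GL t u r 0 0 Gu G0; rewrite !addr0.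
pose H : set (Z * R) :=
  [set vr | exists t ur, G ur /\ vr = (ur.1 + rho t *: v0, ur.2 + t * a)].
exists H, a; split.
- split.
  + by exists 0, (0, 0); rewrite rmorph0 scale0r mul0r !addr0.
  + move=> t _ _ _ _ [t1 [[u1 r1] [Gu1 [-> ->]]]] [t2 [[u2 r2] [Gu2 [-> ->]]]].
    exists (t * t1 + t2), (rho t *: u1 + u2, t * r1 + r2).
    split; first exact: GL.
    rewrite /= rmorphD rmorphM scalerDl mulrDl scalerDr mulrDr -scalerA -mulrA.
    by congr (_, _); exact: addrACA.
  + move=> _ _ [t [[u r] [Gur [-> ->]]]] /=.
    (* Dividing by [|t|] reduces domination to the upper bound on [a] for positive [t] and to the
       lower bound for negative [t]. *)
    have [t0|t0|->] := ltgtP t 0; last first.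
    * by rewrite rmorph0 scale0r mul0r !addr0; exact: Gp.
    * have rt0 : rho t != 0 by rewrite fmorph_eq0 gt_eqF.
      have /a_le := GZ t^-1 u r Gur.
      rewrite -(ler_pM2l t0) mulrBr mulrA divff ?gt_eqF // mul1r.
      rewrite -(p_homo _ _ (ltW t0)) scalerDr scalerA -rmorphM divff ?gt_eqF //.
      by rewrite rmorph1 scale1r lerBrDr addrC.
    * have nt0 : 0 < - t by rewrite oppr_gt0.
      have /a_ge := GZ (- t)^-1 u r Gur.
      rewrite -(ler_pM2l nt0) mulrBr mulrA divff ?gt_eqF // mul1r.
      rewrite -(p_homo _ _ (ltW nt0)) scalerBr scalerA -rmorphM divff ?gt_eqF //.
      by rewrite rmorph1 scale1r rmorphN scaleNr opprK mulNr lerBlDr -lerBlDl opprK addrC.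
- by move=> [u r] Gur; exists 0, (u, r); rewrite rmorph0 scale0r mul0r !addr0.
- by exists 1, (0, 0); rewrite rmorph1 scale1r mul1r !add0r.
Qed.

(** A maximal dominated graph already contains its extension at any vector, so it is defined
    everywhere. *)
Theorem hahn_banach G0 : dominated_graph G0 ->
  exists f : Z -> R, [/\ forall t u v, f (rho t *: u + v) = t * f u + f v,
    forall v, f v <= p v & forall v r, G0 (v, r) -> f v = r].
Proof.
move=> /dominated_graph_maximal[G [G0G dG Gmax]].
have Gtot v : exists r, G (v, r).
  have [H [a [dH GH Hva]]] := dominated_graph_extend G v dG.
  by exists a; exact: Gmax GH _ Hva.
have [g00 GL Gp] := dG.
have [f Gf] := choice Gtot.
have Guniq v r s : G (v, r) -> G (v, s) -> r = s.
  (* The graph contains [(0, s' - r')], and [p 0 = 0]. *)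
  have le r' s' : G (v, r') -> G (v, s') -> s' <= r'.
    move=> Gr Gs; have := GL (-1) v r' v s' Gr Gs.
    rewrite rmorphN rmorph1 scaleN1r addNr mulN1r => /Gp.
    have -> : p 0 = 0 by rewrite -(scale0r 0) -(rmorph0 rho) p_homo // mul0r.
    by rewrite addrC subr_le0.
  by move=> Gr Gs; apply/eqP; rewrite eq_le !le.
exists f; split=> [t u v|v|v r /G0G Gvr].
- by apply: Guniq (Gf _) _; exact: GL.
- exact: Gp.
- exact: Guniq Gvr.
Qed.

End HahnBanach.

(** Extends [m + t w |-> t d], where [d] bounds the distance from [w] to [M] below; this bound is
    what makes the norm dominate. *)
Lemma real_separation {R : realType} {K : numFieldType}
    (rho : {rmorphism R -> K}) {Z : normedModType K} (M : set Z) w :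
  real_embedding rho -> M 0 ->
  (forall t u v, M u -> M v -> M (rho t *: u + v)) -> ~ closure M w ->
  exists f : Z -> R, [/\ forall t u v, f (rho t *: u + v) = t * f u + f v,
    forall v, rho `|f v| <= `|v|, forall m, M m -> f m = 0 & f w != 0].
Proof.
move=> rhoP M0 ML Mw.
have [nu nuE] := choice (fun v : Z => rhoP.2 `|v| (normr_ge0 v)).
have nu_le u x : `|u| <= rho x -> nu u <= x by rewrite nuE rhoP.1.
have nu_subadd u v : nu (u + v) <= nu u + nu v.
  by apply: nu_le; rewrite rmorphD -!nuE ler_normD.
have nu_homo t v : 0 <= t -> nu (rho t *: v) = t * nu v.
  move=> t0; apply: (fmorph_inj rho).
  by rewrite -nuE rmorphM -nuE normrZ (real_embedding_norm rhoP) ger0_norm.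
have nu_ge0 v : 0 <= nu v by rewrite -rhoP.1 rmorph0 -nuE.
have [e e0 eM] : exists2 e : K, 0 < e & forall m, M m -> ~ `|w - m| < e.
  apply: contrapT => h; apply: Mw; apply/closure_ballP => e e0.
  apply: contrapT => h'; apply: h; exists e => // m Mm wm.
  by apply: h'; exists m.
have [d d0 ed] := real_embedding_gt0 rhoP e e0.
have MZ t u : M u -> M (rho t *: u).
  by move=> Mu; rewrite -[_ *: _]addr0; exact: ML.
pose G : set (Z * R) :=
  [set vr | exists m t, M m /\ vr = (m + rho t *: w, t * d)].
have dG : dominated_graph rho nu G.
  split.
  - by exists 0, 0; rewrite rmorph0 scale0r mul0r addr0.
  - move=> t _ _ _ _ [m1 [t1 [Mm1 [-> ->]]]] [m2 [t2 [Mm2 [-> ->]]]].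
    exists (rho t *: m1 + m2), (t * t1 + t2); split; first exact: ML.
    rewrite mulrDl mulrA rmorphD rmorphM scalerDr scalerA scalerDl.
    by congr (_, _); exact: addrACA.
  - move=> _ _ [m [t [Mm [-> ->]]]].
    have [t0|t0] := leP t 0; first by apply: le_trans (nu_ge0 _); rewrite pmulr_lle0.
    have rt0 : rho t != 0 by rewrite fmorph_eq0 gt_eqF.
    have -> : m + rho t *: w = rho t *: (w - rho (- t^-1) *: m).
      rewrite scalerBr scalerA -rmorphM mulrN divff ?gt_eqF // rmorphN rmorph1.
      by rewrite scaleN1r opprK addrC.
    rewrite (nu_homo _ _ (ltW t0)) ler_pM2l // leNgt; apply/negP.
    rewrite -(real_embedding_lt rhoP) -nuE -ed; exact: eM (MZ _ _ Mm).
have [f [fL fnu fG]] := hahn_banach _ _ nu_subadd nu_homo _ dG.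
exists f; split=> // [v|m Mm|].
- rewrite nuE rhoP.1 ler_norml fnu andbT lerNl.
  have f0 : f 0 = 0.
    by have := fL 1 0 0; rewrite rmorph1 scale1r addr0 mul1r => /eqP;
      rewrite -subr_eq0 opprD addNKr oppr_eq0 => /eqP.
  have -> : - f v = f (- v).
    by have := fL (-1) v 0; rewrite !addr0 f0 addr0 rmorphN rmorph1 scaleN1r mulN1r.
  apply: le_trans (fnu _) _; apply: nu_le; by rewrite normrN nuE.
- by apply: fG; exists m, 0; rewrite rmorph0 scale0r mul0r addr0.
- have -> : f w = d; last by rewrite gt_eqF.
  by apply: fG; exists 0, 1; rewrite rmorph1 scale1r mul1r add0r.
Qed.

Lemma bounded_linear_functional {K : numFieldType} {Z : normedModType K}
    (F : Z -> K^o) (c : K) : c \is Num.real -> linear F ->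
  (forall v, `|F v| <= c * `|v|) ->
  exists2 G : {linear Z -> K^o}, continuous G & G =1 F.
Proof.
move=> cR Flin Fc.
pose G : {linear Z -> K^o} := HB.pack F (GRing.isLinear.Build K Z K^o *:%R F Flin).
exists G => //; apply: bounded_linear_continuous; apply/linear_boundedP.
near=> r => v; apply: le_trans (Fc v) _; by apply: ler_wpM2r.
Unshelve. all: by end_near. Qed.

Theorem functional_separation {R : realType} {K : numFieldType}
    (hK : K = R :> numFieldType \/ K = R[i] :> numFieldType)
    {Z : normedModType K} (M : set Z) w :
  M 0 -> (forall a u v, M u -> M v -> M (a *: u + v)) -> ~ closure M w ->
  exists F : {linear Z -> K^o}, [/\ continuous F, forall m, M m -> F m = 0 &
    F w != 0].
Proof.
case: hK => eK; subst K => M0 ML Mw.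
  have [|f [fL f_le fM fw]] :=
    real_separation _ M w (real_embedding_id R) M0 _ Mw; first by move=> t; exact: ML.
  have [|F cF FE] := bounded_linear_functional (f : Z -> R^o) 1 (real1 _) fL.
    by move=> v; rewrite mul1r; exact: f_le.
  by exists F; split=> // [m Mm|]; rewrite FE //; exact: fM.
have [|f [fL f_le fM fw]] :=
    real_separation _ M w (real_embedding_complex R) M0 _ Mw; first by move=> t; exact: ML.
pose J : R[i] := 'i%C.
have aE (a : R[i]) : a = (complex.Re a)%:C%C + (complex.Im a)%:C%C * J.
  by apply/eqP; case: a => x y; rewrite eq_complex /=; apply/andP; split; apply/eqP; ring.
have f0 : f 0 = 0.
  have := fL 1 0 0; rewrite rmorph1 scale1r addr0 mul1r => /eqP.
  by rewrite -subr_eq0 opprD addNKr oppr_eq0 => /eqP.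
have fC (a : R[i]) u v : f (a *: u + v) =
    complex.Re a * f u + complex.Im a * f (J *: u) + f v.
  by rewrite {1}(aE a) scalerDl -scalerA -addrA !fL addrA.
(* The complex-linear functional with real part [f]; it kills [M] because [M] is stable under
   multiplication by [J]. *)
pose F (v : Z) : R[i]^o := (f v -i* f (J *: v))%C.
have Flin : linear F.
  move=> a u v; rewrite /F scalerDr scalerA !fC; case: a => x y.
  apply/eqP; rewrite eq_complex /=; apply/andP; split; apply/eqP; ring.
have J1 : `|J| = 1.
  by rewrite normc_def /= expr0n add0r expr1n sqrtr1.
have [v|G cG GE] := bounded_linear_functional F 2 (realn _ 2) Flin.
  have -> : F v = (f v)%:C%C - J * (f (J *: v))%:C%C.
    by apply/eqP; rewrite eq_complex /=; apply/andP; split; apply/eqP; ring.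
  apply: le_trans (ler_normB _ _) _; rewrite normrM J1 mul1r mulr_natl mulr2n.
  rewrite !(real_embedding_norm (real_embedding_complex R)) lerD //.
  by apply: le_trans (f_le _) _; rewrite normrZ J1 mul1r.
exists G; split=> // [m Mm|].
  rewrite GE /F !fM // ?oppr0 //.
  by rewrite -[_ *: _]addr0; exact: ML.
by rewrite GE; apply: contra fw => /eqP[->].
Qed.

(** * Weak hypercyclicity *)

(** The weak topology refines the initial topology of each continuous functional. *)
Lemma continuous_weak {K : numFieldType} {Z : normedModType K}
    (F : {linear Z -> K^o}) :
  continuous F -> continuous (F : weak Z -> K^o).
Proof.
move=> cF x; pose i : {f : {linear Z -> K^o} | continuous f} := exist _ F cF.
have [h _] := @cvg_sup Z _ (fun f : {f : {linear Z -> K^o} | continuous f} =>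
  Topological.on (initial_topology (sval f))) (nbhs (x : weak Z)) x _.
have {}h := h (fun _ => id) i.
exact: (cvg_trans (cvg_app _ h) (@initial_continuous _ _ F x)).
Qed.

Lemma linear_spanZD {K : numFieldType} {Z : lmodType K} (S : set Z) a u v :
  linear_span S u -> linear_span S v -> linear_span S (a *: u + v).
Proof.
move=> Su Sv V VS; have [[_ VL] _] := VS.
by apply: set_mem; apply: VL; apply: mem_set; [exact: Su|exact: Sv].
Qed.

Lemma linear_span0 {K : numFieldType} {Z : lmodType K} (S : set Z) :
  linear_span S 0.
Proof. by move=> V [[V0 _] _]; exact: set_mem. Qed.

(* The even and the odd part of the orbit span two subspaces; if neither is
   dense, then each is killed by a nonzero functional, and some weakly open set
   avoids both kernels. *)
Lemma weakly_hypercyclic_cyclic_sqr {R : realType} {K : numFieldType}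
    (hK : K = R :> numFieldType \/ K = R[i] :> numFieldType)
    {Z : normedModType K} (A : Z -> Z) :
  weakly_hypercyclic A -> cyclic (A \o A).
Proof.
move=> [z dz]; apply: contrapT => ncyc.
have killer y : exists F : {linear Z -> K^o}, exists u, [/\ continuous F,
    forall n, F (iter n (A \o A) y) = 0 & F u != 0].
  have [u Mu] : exists u, ~ closure (linear_span (orbit (A \o A) y)) u.
    apply/existsNP => h; apply: ncyc; exists y; exact/dense_closureP.
  have [F [cF FM Fu]] := functional_separation hK _ u (linear_span0 _)
    (fun a u v => @linear_spanZD _ _ _ a u v) Mu.
  exists F, u; split=> // n; apply: FM; apply: sub_gen_smallest; by exists n.
(* [F] kills the even half of the orbit, and [G] the odd half, which is the orbit of [A z] under
   [A \o A]. *)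
have [F [u [cF Fz Fu]]] := killer z; have [G [v [cG Gz Gv]]] := killer (A z).
(* Two proper subspaces do not cover [Z]: one of [u], [v], [u + v] avoids both kernels. *)
have [w Fw Gw] : exists2 w, F w != 0 & G w != 0.
  have [Gu|Gu] := eqVneq (G u) 0; last by exists u.
  have [Fv|Fv] := eqVneq (F v) 0; last by exists v.
  by exists (u + v); rewrite linearD ?Fv ?Gu ?addr0 ?add0r.
pose O : set (weak Z) := F @^-1` [set~ 0] `&` G @^-1` [set~ 0].
have op (H : {linear Z -> K^o}) : continuous H ->
    open (H @^-1` [set~ 0] : set (weak Z)).
  move=> cH; apply: open_comp => [x _|]; first exact: continuous_weak.
  by apply: closed_openC; exact/accessible_closed_set1/hausdorff_accessible/norm_hausdorff.
have [||q [[/= FO GO] [n _ nE]]] := dz O.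
- by exists w; split; apply/eqP.
- by apply: openI; exact: op.
have iter2 y m : iter m (A \o A) y = iter m.*2 A y by elim: m => //= m ->.
have := odd_double_half n; case: (ssrnat.odd n) => nn.
  by apply: GO; rewrite -nE -nn add1n iterSr -iter2.
by apply: FO; rewrite -nE -nn -iter2.
Qed.

Theorem corollary3p1 (R : realType) (K : numFieldType)
    (hK : K = R :> numFieldType \/ K = R[i] :> numFieldType)
    (X : completeNormedModType K) (hX : infinite_dimensional X)
    (T : {linear X -> X}) (hT : bounded_near T (nbhs (0 : X)))
    (hypT : hypercyclic T) (hypTT : ~ hypercyclic (direct_sum T T)) :
  [/\ convex_cyclic (direct_sum T (\- T)),
      ~ weakly_hypercyclic (direct_sum T (\- T))
    & ~ cyclic (direct_sum T (\- T) \o direct_sum T (\- T))].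
Proof.
have cT : continuous T by apply/linear_bounded_continuous.
have [rho rhoP] := ex_real_embedding hK.
have ncyc : ~ cyclic (direct_sum T (\- T) \o direct_sum T (\- T)).
  move=> /cyclic_direct_sum_sqr cTT; apply: hypTT.
  exact: hypercyclic_direct_sum (real_embedding_archi rhoP) cT hypT cTT.
split=> //; first exact: convex_cyclic_direct_sum_opp rhoP cT hypT.
by move=> /(weakly_hypercyclic_cyclic_sqr hK).
Qed.
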